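(* Let $|\cdot|$ be an arbitrary norm on $\mathbb R^n$ induced by an inner product, and let $\varphi=\frac{1+\sqrt5}{2}$. For every integer $n\geq2$ and every $\alpha\in\mathbb R^n\setminus\mathbb Q^n$, $$\underline{\mathcal D}_n(\alpha)\leq\left\lfloor 2^{n-1}\frac{\log 2}{\log\varphi}\right\rfloor+1.$$ In particular, $\underline{\mathcal D}_2(\alpha)\leq3$ for every $\alpha\in\mathbb R^2\setminus\mathbb Q^2$ and $\underline{\mathcal D}_3(\alpha)\leq6$ for every $\alpha\in\mathbb R^3\setminus\mathbb Q^3$.
   Context: The norm is $|x|=\sqrt{\langle x,x\rangle}$ for an arbitrary inner product $\langle\cdot,\cdot\rangle$ on $\mathbb R^n$. On the torus $\mathbb T^n=\mathbb R^n/\mathbb Z^n$ put $\rho(x,y)=\min_{z\in\mathbb Z^n}|x-y-z|$. For $\alpha\in\mathbb R^n\setminus\mathbb Q^n$, a positive integer $N$ and an integer $0\leq q\leq N$, set $$D_q(N)=\min_{\substack{0\leq t\leq N\\ t\neq q}}\rho(q\alpha,t\alpha),\qquad \mathcal D_n(\alpha,N)=\#\{D_q(N):0\leq q\leq N\},$$ where $t$ ranges over integers; thus $\mathcal D_n(\alpha,N)$ is the number of distinct distances from the points $0,\alpha,\ldots,N\alpha$ to their nearest neighbors. Set $\underline{\mathcal D}_n(\alpha)=\liminf_{N\to\infty}\mathcal D_n(\alpha,N)$. *)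

(* Defs.v *)
From HB Require Import structures.
From mathcomp Require Import all_boot all_order all_algebra.
From mathcomp Require Import all_classical all_reals all_analysis.

Set Implicit Arguments.
Unset Strict Implicit.
Unset Printing Implicit Defensive.

Import Order.TTheory GRing.Theory Num.Theory.
Local Open Scope classical_set_scope.
Local Open Scope ring_scope.

(* With theta := idfun, the type {dot _ for _} is that of symmetric bilinear
   positive definite forms. *)
Definition inner_product (R : realType) (n : nat) : Type :=
  {dot 'rV[R]_n for (@idfun R)}.

Definition ipnorm (R : realType) (n : nat) (f : inner_product R n)
  (x : 'rV[R]_n) : R := Num.sqrt (f x x).

Definition Zvec (R : realType) (n : nat) : set 'rV[R]_n :=
  range (fun z : 'rV[int]_n => map_mx (fun k : int => k%:~R) z).

Definition Qvec (R : realType) (n : nat) : set 'rV[R]_n :=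
  range (fun q : 'rV[rat]_n => map_mx (fun r : rat => ratr r) q).

(* Points of the torus R^n / Z^n are given by representatives x, y in R^n; the
   value is unchanged when an integer vector is added to x or y.  The norm comes
   from a positive definite form and Z^n is a lattice, so this infimum of a
   nonempty set is attained, i.e. it is a minimum. *)
Definition rho (R : realType) (n : nat) (f : inner_product R n)
  (x y : 'rV[R]_n) : R :=
  inf [set ipnorm f (x - y - z) | z in @Zvec R n].

(* The infimum of a finite set, nonempty (hence a minimum) as soon as N > 0;
   the value at N = 0 is junk and has no effect on a limit inferior in N. *)
Definition nn_dist (R : realType) (n : nat) (f : inner_product R n)
  (alpha : 'rV[R]_n) (N q : nat) : R :=
  inf [set rho f (alpha *+ q) (alpha *+ t) |
         t in [set t : nat | (t <= N)%N /\ t <> q]].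

Definition nb_dist (R : realType) (n : nat) (f : inner_product R n)
  (alpha : 'rV[R]_n) (N : nat) : nat :=
  size (undup [seq nn_dist f alpha N q | q <- iota 0 N.+1]).

Definition liminf_nb_dist (R : realType) (n : nat) (f : inner_product R n)
  (alpha : 'rV[R]_n) : \bar R :=
  limn_einf (fun N : nat => ((nb_dist f alpha N)%:R : R)%:E).

Definition golden (R : realType) : R := (1 + Num.sqrt 5) / 2.

(* Main.v *)
Require Import Defs.
From HB Require Import structures.
From mathcomp Require Import all_boot all_order all_algebra.
From mathcomp Require Import all_classical all_reals all_analysis.
From mathcomp Require Import zify ring lra.

(** Nearest neighbour distances only depend on differences of indices: D_q(N) is
    the minimum of the distances from k alpha to the integer lattice for
    1 <= k <= max (q, N - q).  Hence, for N = 2M, the number of distinct distances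
    is at most one more than the number of records in (M, 2M], a record being an
    index k whose distance to the lattice is strictly smaller than those of all
    its predecessors.  A liminf larger than s therefore forces s records into
    (M, 2M] for every large M; listing the large records as q_0 < q_1 < ..., one
    gets q_(k+s) <= 2 q_k for all k.

    In the other direction, put m = 2^(n-1).  As long as q_(k+m) <= 2 q_k, which
    holds here because s > m, the records satisfy q_(k+2m) >= q_(k+m) + q_k
    (minimal_growth).  To see this, attach to each record a lattice point
    w_k = (q_k, p_k) of Z^(n+1) with q_k alpha - p_k shorter than q alpha - p for
    all 0 < q < q_k and all p.  The parallelogram law shows that, for records
    q_i < q_j < q_l,
    - w_i is nonzero modulo 2;
    - w_i and w_j are distinct modulo 2 if q_j < 3 q_i;
    - w_i + w_j + w_l is nonzero modulo 2 if q_l < q_i + q_j.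
    If the inequality failed, the sums of two classes among the m + 1 points
    w_(k+m), ..., w_(k+2m) would avoid the 2m + 1 distinct classes of
    w_k, ..., w_(k+2m).  In a vector space over the field with two elements, a set
    of more than 2^r vectors has at least 2^(r+1) sums (card_sumset_pow2), so there
    are at least 2m sums of two classes.  This makes 4m + 1 classes among the
    2^(n+1) = 4m of them.

    The recurrence makes q_(m t) grow at least like the t-th power of the golden
    ratio phi, so that q_(k+s) <= 2 q_k implies phi^s <= 2^m (golden_growth).  The
    bound follows by taking for s the least integer exceeding m log 2 / log phi; in
    dimensions 2 and 3 it is evaluated with phi^3 > 4. *)

Set Implicit Arguments.
Unset Strict Implicit.
Unset Printing Implicit Defensive.

Import Order.TTheory GRing.Theory Num.Theory.
Local Open Scope ring_scope.

(** * Sumsets over the field with two elements *)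

(** The Minkowski sum of two subsets of the vector space over the field with two
    elements. *)
Definition sumset d (A B : {set 'rV['F_2]_d}) : {set 'rV['F_2]_d} :=
  [set x + y | x in A, y in B]%SET.

Lemma sumsetC d (A B : {set 'rV['F_2]_d}) : sumset A B = sumset B A.
Proof.
by apply/finset.setP => z; apply/imset2P/imset2P => -[x y xA yB ->];
  exists y x => //; rewrite addrC.
Qed.

Lemma card_sumset_ge d (A B : {set 'rV['F_2]_d}) :
  (0 < #|B|)%N -> (#|A| <= #|sumset A B|)%N.
Proof.
case/card_gt0P => b bB; rewrite -(card_imset (mem A) (addIr b)).
by apply/subset_leq_card/fintype.subsetP => _ /imsetP[a aA ->]; apply: imset2_f.
Qed.

(** The power-of-two case of the Hopf-Stiefel bound for sumsets.  A coordinate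
    that separates two elements of the smaller set cuts both sets in two halves;
    the vectors of the sumset whose coordinate vanishes contain the sums of like
    halves, the others contain the sums of unlike halves, and the induction
    hypothesis yields half of the bound for each kind. *)
Lemma card_sumset_pow2 d r (A B : {set 'rV['F_2]_d}) :
  (0 < #|A|)%N -> (0 < #|B|)%N -> (2 ^ r < #|A| + #|B|)%N ->
  (2 ^ r <= #|sumset A B|)%N.
Proof.
elim: r A B => [|r IH] A B A0 B0 AB.
  exact: leq_trans A0 (card_sumset_ge A B0).
wlog BA : A B A0 B0 AB / (#|B| <= #|A|)%N.
  move=> W; case/orP: (leq_total #|A| #|B|) => h; last exact: W.
  by rewrite sumsetC; apply: W => //; rewrite addnC.
have [B1|B1] := leqP #|B| 1.
  by apply: leq_trans (card_sumset_ge A B0); lia.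
have [b [b' [bB b'B nbb']]] : exists b b', [/\ b \in B, b' \in B & b != b'].
  by case/card_gt1P: B1 => b [b' [? ? ?]]; exists b, b'.
have /existsP[i bi] : [exists i, b 0 i != b' 0 i].
  apply: contraNT nbb' => /existsPn h; apply/eqP/rowP => i.
  by apply/eqP/negPn/h.
pose H := [set x : 'rV['F_2]_d | x 0 i == 0]%SET.
have splitC (X : {set 'rV['F_2]_d}) : #|X| = (#|X :&: H| + #|X :\: H|)%N.
  by rewrite cardsID.
have B00 : (0 < #|B :&: H|)%N.
  have : (b \in H) || (b' \in H).
    by rewrite !inE; move: bi; case: (b 0 i) (b' 0 i) => [[|[|?]] ?] [[|[|?]] ?].
  by case/orP => h; apply/card_gt0P; [exists b | exists b']; rewrite inE ?bB ?b'B.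
have B10 : (0 < #|B :\: H|)%N.
  have : (b \notin H) || (b' \notin H).
    by rewrite !inE; move: bi; case: (b 0 i) (b' 0 i) => [[|[|?]] ?] [[|[|?]] ?].
  by case/orP => h; apply/card_gt0P; [exists b | exists b']; rewrite inE ?bB ?b'B h.
have eqH x y : (x + y \in H) = ((x \in H) == (y \in H)).
  rewrite !inE mxE.
  by case: (x 0 i) (y 0 i) => [[|[|?]] ?] [[|[|?]] ?].
rewrite (splitC (sumset A B)) expnS mul2n -addnn.
have IH' (X Y Z : {set 'rV['F_2]_d}) : (forall x y, x \in X -> y \in Y -> x + y \in Z) ->
   (0 < #|X|)%N -> (0 < #|Y|)%N -> (2 ^ r < #|X| + #|Y|)%N -> (2 ^ r <= #|Z|)%N.
  move=> h X0 Y0 XY; apply: leq_trans (IH X Y X0 Y0 XY) _.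
  by apply/subset_leq_card/fintype.subsetP => _ /imset2P[x y xX yY ->]; apply: h.
have e00 x y : x \in A :&: H -> y \in B :&: H -> x + y \in sumset A B :&: H.
  rewrite !finset.in_setI eqH => /andP[xA ->] /andP[yB ->].
  by rewrite eqxx andbT imset2_f.
have e11 x y : x \in A :\: H -> y \in B :\: H -> x + y \in sumset A B :&: H.
  rewrite finset.in_setI !finset.in_setD eqH => /andP[/negPf-> xA] /andP[/negPf-> yB].
  by rewrite eqxx andbT imset2_f.
have e01 x y : x \in A :&: H -> y \in B :\: H -> x + y \in sumset A B :\: H.
  rewrite !finset.in_setD finset.in_setI eqH => /andP[xA ->] /andP[/negPf-> yB].
  by rewrite /= imset2_f.
have e10 x y : x \in A :\: H -> y \in B :&: H -> x + y \in sumset A B :\: H.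
  rewrite !finset.in_setD finset.in_setI eqH => /andP[/negPf-> xA] /andP[yB ->].
  by rewrite /= imset2_f.
have := splitC A; have := splitC B; move: AB; rewrite expnS => AB eB eA.
apply: leq_add.
  (* When a half of A is empty, A is the other half, and it has more than
     2 ^ r elements because it is the larger set. *)
  have [h|h] := ltnP (2 ^ r) (#|A :&: H| + #|B :&: H|).
    have [z|z] := posnP #|A :&: H|; last exact: (IH' _ _ _ e00).
    by apply: (IH' _ _ _ e11) => //; lia.
  have [z|z] := posnP #|A :\: H|; last by apply: (IH' _ _ _ e11) => //; lia.
  by lia.
have [h|h] := ltnP (2 ^ r) (#|A :&: H| + #|B :\: H|).
  have [z|z] := posnP #|A :&: H|; last exact: (IH' _ _ _ e01).
  by apply: (IH' _ _ _ e10) => //; lia.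
have [z|z] := posnP #|A :\: H|; last by apply: (IH' _ _ _ e10) => //; lia.
by lia.
Qed.

(** * Lattice points with minimal displacement *)

(** A pair (q, p) of an integer and an integer vector is a point of the lattice
    of rank n + 1; its displacement is the vector q alpha - p. *)
Definition disp (R : realType) n (alpha : 'rV[R]_n) (w : int * 'rV[int]_n) :
  'rV[R]_n := alpha *~ w.1 - map_mx (fun k : int => k%:~R) w.2.

(** The squared norm of the displacement. *)
Definition sqdist (R : realType) n (f : inner_product R n) (alpha : 'rV[R]_n)
  (w : int * 'rV[int]_n) : R := f (disp alpha w) (disp alpha w).

(** The class of a lattice point modulo 2. *)
Definition parity n (w : int * 'rV[int]_n) : 'rV['F_2]_(1 + n) :=
  row_mx (const_mx w.1%:~R) (map_mx (fun k : int => k%:~R) w.2).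

(** A lattice point (q, p) with q > 0 is minimal when its displacement is strictly
    shorter than that of every point whose first coordinate lies strictly
    between 0 and q.  Nothing is asked of p among the points with the same q: p
    need not be a nearest integer vector to q alpha. *)
Definition minimal (R : realType) n (f : inner_product R n) (alpha : 'rV[R]_n)
  (w : int * 'rV[int]_n) : Prop :=
  0 < w.1 /\
  forall y : int * 'rV[int]_n,
    0 < y.1 -> y.1 < w.1 -> sqdist f alpha w < sqdist f alpha y.

Lemma inner_ge0 (R : realType) n (f : inner_product R n) x : 0 <= f x x.
Proof.
have [->|x0] := eqVneq x 0; first by rewrite linear0l.
exact/ltW/neq0_dnorm_gt0.
Qed.

Lemma innerN (R : realType) n (f : inner_product R n) x : f (- x) (- x) = f x x.
Proof. by rewrite linearNl linearNr opprK. Qed.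

Lemma dispD (R : realType) n (alpha : 'rV[R]_n) x y :
  disp alpha (x + y) = disp alpha x + disp alpha y.
Proof.
rewrite /disp mulrzDr addrACA -opprD; congr (_ - _).
by apply/rowP => i; rewrite !mxE intrD.
Qed.

Lemma dispN (R : realType) n (alpha : 'rV[R]_n) x :
  disp alpha (- x) = - disp alpha x.
Proof.
rewrite /disp mulrNz opprB addrC; congr (_ - _).
by apply/rowP => i; rewrite !mxE intrN opprK.
Qed.

Lemma parityD n (x y : int * 'rV[int]_n) : parity (x + y) = parity x + parity y.
Proof.
apply/rowP => i; rewrite !mxE; case: fintype.split => j; rewrite !mxE.
  exact: intrD.
exact: intrD.
Qed.

Lemma F2_int_eq0 (k : int) : k%:~R = 0 :> 'F_2 -> k = (k %/ 2)%Z + (k %/ 2)%Z.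
Proof.
move/eqP; rewrite -(dvdz_pcharf (pchar_Fp (isT : prime 2))) => /dvdzP[h ->].
by rewrite mulzK //; lia.
Qed.

Lemma parity_eq0 n (w : int * 'rV[int]_n) :
  parity w = 0 -> exists h, w = h + h.
Proof.
move=> w0; exists ((w.1 %/ 2)%Z, map_mx (fun k => (k %/ 2)%Z) w.2).
case: w w0 => q p /= w0; congr (_, _).
  apply: F2_int_eq0; have := congr1 (fun M : 'rV_(1 + n) => M 0 (lshift n ord0)) w0.
  by rewrite row_mxEl !mxE.
apply/rowP => i; rewrite !mxE; apply: F2_int_eq0.
have := congr1 (fun M : 'rV_(1 + n) => M 0 (rshift 1 i)) w0.
by rewrite row_mxEr !mxE.
Qed.

Lemma addF2 d (x : 'rV['F_2]_d) : x + x = 0.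
Proof. by apply/rowP => i; rewrite !mxE; case: (x 0 i) => [[|[|?]] ?]; apply/val_inj. Qed.

Section Parity.
Variables (R : realType) (n : nat) (f : inner_product R n) (alpha : 'rV[R]_n).
Local Notation Q := (sqdist f alpha).
Implicit Types x y z w h : (int * 'rV[int]_n)%type.

Lemma sqdist_ge0 w : 0 <= Q w. Proof. exact: inner_ge0. Qed.

Lemma sqdist_parallelogram x y : Q (x + y) + Q (x - y) = 2 * (Q x + Q y).
Proof.
rewrite /sqdist !dispD dispN; move: (disp alpha x) (disp alpha y) => u v.
by have := hnormD f u v; have := hnormB f u v => /= -> ->; lra.
Qed.

Lemma sqdist_double h : Q (h + h) = 4 * Q h.
Proof.
have := sqdist_parallelogram h h; have := sqdist_parallelogram 0 0.
by rewrite addr0 !subrr; lra.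
Qed.

Lemma sqdist_half2 x y h : x + y = h + h -> Q x + Q y = 2 * (Q h + Q (h - x)).
Proof.
move=> e; rewrite -sqdist_parallelogram subKr addrA -e.
by rewrite [x + y]addrC addrK addrC.
Qed.

(** The four vectors are, up to sign, the halves of x + y + z, y + z - x,
    x + z - y and x + y - z. *)
Lemma sqdist_half3 x y z h : x + y + z = h + h ->
  Q h + Q (h - x) + Q (h - y) + Q (h - z) = Q x + Q y + Q z.
Proof.
move=> e; have := sqdist_parallelogram (h - x) (h - y).
have := sqdist_parallelogram h (h - z); have := sqdist_parallelogram y x.
have -> : h - x + (h - y) = z.
  by rewrite addrACA -opprD -e addrC addKr.
have -> : h - x - (h - y) = y - x by rewrite opprB addrC addrA subrK.
have -> : h + (h - z) = y + x by rewrite addrA -e addrK addrC.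
rewrite subKr.
lra.
Qed.

(** Otherwise half of x would be a lattice point with a smaller positive first
    coordinate and with a displacement no longer than that of x. *)
Lemma minimal_parity_neq0 x : minimal f alpha x -> parity x <> 0.
Proof.
move=> [x0 mx] /parity_eq0[h xh]; have /= x1 := congr1 fst xh.
have := sqdist_ge0 h; have : Q x < Q h by apply: mx => /=; lia.
rewrite xh sqdist_double; lra.
Qed.

(** Otherwise (y - x) / 2 would be a lattice point with first coordinate below
    that of x, and its squared norm is at most the mean of those of x and y. *)
Lemma minimal_parity_neq x y : minimal f alpha x -> minimal f alpha y ->
  x.1 < y.1 -> y.1 < 3 * x.1 -> parity x <> parity y.
Proof.
move=> [x0 mx] [y0 my] xy yx pxy.
have /parity_eq0[h e] : parity (x + y) = 0 by rewrite parityD pxy addF2.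
have /= e1 := congr1 fst e.
have := sqdist_half2 e; have := sqdist_ge0 h; have := my x x0 xy.
have : Q x < Q (h - x) by apply: mx => /=; lia.
lra.
Qed.

(** Otherwise the four half sums of sqdist_half3 are lattice points.  Three of
    them have first coordinates small enough for minimality to apply, and this
    makes the sum of the four squared norms too large. *)
Lemma minimal_parity_sum_neq0 x y z :
  minimal f alpha x -> minimal f alpha y -> minimal f alpha z ->
  x.1 < y.1 -> y.1 < z.1 -> z.1 < x.1 + y.1 ->
  parity x + parity y + parity z <> 0.
Proof.
move=> [x0 mx] [y0 my] [z0 mz] xy yz zxy; rewrite -!parityD => /parity_eq0[h e].
have /= e1 := congr1 fst e.
have := sqdist_half3 e; have := sqdist_ge0 h; have := mz x x0 ltac:(lia).
have : Q x < Q (h - y) by apply: mx => /=; lia.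
have : Q x < Q (h - z) by apply: mx => /=; lia.
have : Q y < Q (h - x) by apply: my => /=; lia.
lra.
Qed.

End Parity.

(** The recurrence behind the golden ratio, with m = 2 ^ n in dimension n + 1.  If
    it failed, the classes modulo 2 of the 2m + 1 points x 0, ..., x (2m) would be
    distinct, and none of them would be a sum of two classes of the m + 1 points
    x m, ..., x (2m).  There are at least 2m such sums, and only 4m classes. *)
Lemma minimal_growth (R : realType) n (f : inner_product R n.+1)
    (alpha : 'rV[R]_n.+1) (x : nat -> int * 'rV[int]_n.+1) :
  (forall i, minimal f alpha (x i)) ->
  {homo x : i j / (i < j)%N >-> i.1 < j.1} ->
  (x (2 ^ n)%N).1 <= 2 * (x 0%N).1 ->
  (x (2 ^ n)%N).1 + (x 0%N).1 <= (x (2 ^ n.+1)%N).1.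
Proof.
move=> mx ix; set m := (2 ^ n)%N => xm2; rewrite leNgt; apply/negP => lt.
have dm : (2 ^ n.+1 = m + m)%N by rewrite expnS mul2n addnn.
rewrite dm in lt.
have lex i j : (i <= j)%N -> (x i).1 <= (x j).1.
  by rewrite leq_eqVlt => /orP[/eqP->//|/ix/ltW].
have P2 i j : (i < j <= m + m)%N -> parity (x i) <> parity (x j).
  case/andP=> ij jm; apply: minimal_parity_neq (ix _ _ ij) _ => //.
  have := lex _ _ jm; have := lex 0%N i isT; lia.
have P3 i j k : (i < j)%N -> (j < k)%N -> (m <= j)%N -> (k <= m + m)%N ->
    parity (x i) + parity (x j) + parity (x k) <> 0.
  move=> ij jk mj km; apply: (@minimal_parity_sum_neq0 _ _ f alpha) => //; try exact: ix.
  have := lex _ _ km; have := lex 0%N i isT; have := lex _ _ mj; lia.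
have injP i j : (i <= m + m)%N -> (j <= m + m)%N -> parity (x i) = parity (x j) -> i = j.
  move=> im jm e; have [ij|ji|//] := ltngtP i j.
    by case: (P2 i j); rewrite ?ij.
  by case: (P2 j i); rewrite ?ji.
pose T := [set parity (x i) | i : 'I_(m + m).+1]%SET.
pose B := [set parity (x (m + i)%N) | i : 'I_m.+1]%SET.
have cT : #|T| = (m + m).+1.
  rewrite card_imset ?card_ord // => i j e; apply/val_inj.
  exact: injP (ltn_ord i) (ltn_ord j) e.
have cB : #|B| = m.+1.
  rewrite card_imset ?card_ord // => i j e; apply/val_inj/(@addnI m).
  have := ltn_ord i; have := ltn_ord j => jm im.
  by apply: injP e; rewrite leq_add2l.
have cBB : (m + m <= #|sumset B B|)%N.
  by rewrite -dm; apply: card_sumset_pow2; rewrite ?cB // dm; lia.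
have dis : [disjoint T & sumset B B].
  apply/pred0P => v /=; apply/negP => /andP[/imsetP[[t tm] _ ->]].
  case/imset2P => _ _ /imsetP[[i im] _ ->] /imsetP[[j jm] _ ->] /=.
  wlog ij : i j im jm / (i <= j)%N.
    move=> W e; case/orP: (leq_total i j) => h; first exact: (W i j).
    by apply: (W j i) => //; rewrite addrC.
  move=> e; have e0 : parity (x t) + parity (x (m + i)%N) + parity (x (m + j)%N) = 0.
    by rewrite -addrA -e addF2.
  have N0 k : parity (x k) <> 0 by apply: minimal_parity_neq0 (mx k).
  have mi : (i < m.+1)%N := im; have mj : (j < m.+1)%N := jm.
  have [eij|nij] := eqVneq i j.
    by case: (N0 t); rewrite e eij addF2.
  have [eti|nti] := eqVneq t (m + i)%N.
    case: (N0 (m + j)%N); apply: (addrI (parity (x (m + i)%N))).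
    by rewrite -e addr0 eti.
  have [etj|ntj] := eqVneq t (m + j)%N.
    case: (N0 (m + i)%N); apply: (addIr (parity (x (m + j)%N))).
    by rewrite -e add0r etj.
  (* The three indices are now distinct, and at most t is below m, so that
     the middle one is at least m whatever their order. *)
  have [ti|ti] := ltnP t (m + i)%N.
    by apply: (P3 t (m + i)%N (m + j)%N) e0; lia.
  have [tj|tj] := ltnP t (m + j)%N.
    by apply: (P3 (m + i)%N t (m + j)%N); rewrite 1?[_ + parity (x t)]addrC //; lia.
  apply: (P3 (m + i)%N (m + j)%N t); rewrite 1?[_ + parity (x t)]addrC 1?addrA //; lia.
have := max_card (mem (T :|: sumset B B)%SET).
rewrite cardsU (finset.disjoint_setI0 dis) cards0 subn0 cT.
rewrite card_mx card_Fp //; move: #|sumset B B| cBB => c.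
rewrite mul1n add1n expnS dm; lia.
Qed.

(** * Growth and the golden ratio *)

Lemma golden_sq (R : realType) : golden R ^+ 2 = golden R + 1.
Proof.
have s5 : Num.sqrt 5 ^+ 2 = 5 :> R by rewrite sqr_sqrtr.
by rewrite /golden; move: (Num.sqrt 5 : R) s5 => s s5; field: s5.
Qed.

Lemma golden_gt1 (R : realType) : 1 < golden R.
Proof.
have : 1 < Num.sqrt 5 :> R by rewrite -[ltLHS]sqrtr1 ltr_sqrt // ltr1n.
by rewrite /golden; lra.
Qed.

Lemma golden_lt2 (R : realType) : golden R < 2.
Proof.
have : 0 < golden R by apply: lt_trans (golden_gt1 R).
have := golden_sq R; nra.
Qed.

Lemma bernoulli_le (R : realType) (d : R) u : 0 <= d -> 1 + u%:R * d <= (1 + d) ^+ u.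
Proof.
move=> d0; elim: u => [|u IH]; first by rewrite mul0r addr0 expr0.
rewrite exprS; apply: le_trans (ler_wpM2l _ IH); last by lra.
rewrite -natr1; have : 0 <= u%:R * (d * d) by rewrite !mulr_ge0.
lra.
Qed.

(** Along multiples of m the sequence dominates a Fibonacci sequence, so that
    a (m * (s * u)) is at least of order golden ^ (s * u), whereas doubling bounds it by
    2 ^ (m * u) * a 0. *)
Lemma golden_growth (R : realType) (a : nat -> nat) m s :
  (0 < a 0)%N -> (0 < a m)%N ->
  (forall k, a (k + m) + a k <= a (k + (m + m)))%N ->
  (forall k, a (k + s) <= 2 * a k)%N ->
  golden R ^+ s <= 2 ^+ m.
Proof.
move=> a0 am fib dbl; have g1 := golden_gt1 R; have gsq := golden_sq R.
have lower t : golden R ^+ t <= golden R * (a (m * t)%N)%:R /\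
               golden R ^+ t.+1 <= golden R * (a (m * t.+1)%N)%:R.
  elim: t => [|t [IH0 IH1]]; split => //.
  - rewrite muln0 expr0.
    have : (1 : R) <= (a 0%N)%:R by rewrite ler1n.
    nra.
  - rewrite muln1 expr1.
    have : (1 : R) <= (a m)%:R by rewrite ler1n.
    nra.
  - have := fib (m * t)%N; rewrite -(ler_nat R) natrD.
    have -> : (m * t + m = m * t.+1)%N by lia.
    have -> : (m * t + (m + m) = m * t.+2)%N by lia.
    move=> h; rewrite !exprS mulrA -expr2 gsq mulrDl mul1r -exprS.
    apply: le_trans (lerD IH1 IH0) _; rewrite -mulrDr ler_pM2l.
      exact: h.
    by lra.
have upper t : (a (s * t)%N)%:R <= 2 ^+ t * (a 0%N)%:R :> R.
  elim: t => [|t IH]; first by rewrite muln0 expr0 mul1r.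
  rewrite mulnS addnC exprS -mulrA; apply: le_trans (ler_wpM2l _ IH) => //.
  by rewrite -[2 * _]natrM ler_nat.
rewrite leNgt; apply/negP => lt.
have p2 : 0 < 2 ^+ m :> R by rewrite exprn_gt0.
pose d := golden R ^+ s / 2 ^+ m - 1.
have d0 : 0 < d by rewrite subr_gt0 ltr_pdivlMr // mul1r.
have bnd u : 1 + u%:R * d <= golden R * (a 0%N)%:R.
  apply: le_trans (bernoulli_le u (ltW d0)) _.
  rewrite addrC subrK expr_div_n ler_pdivrMr ?exprn_gt0 // -!exprM.
  have [h _] := lower (s * u)%N; apply: le_trans h _.
  rewrite -[leRHS]mulrA ler_pM2l; last by lra.
  by rewrite mulrC mulnCA; exact: upper.
have [u hu] : exists u : nat, golden R * (a 0%N)%:R / d < u%:R.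
  by exists (Num.bound (golden R * (a 0%N)%:R / d)); apply: archi_boundP;
    rewrite divr_ge0 ?mulr_ge0 //; lra.
have := bnd u; move: hu; rewrite ltr_pdivrMr //; lra.
Qed.

(** The sequence q enumerates in increasing order the elements of P above some
    point.  Since the interval (q k, 2 q k] contains at least s elements of P, it
    contains q (k + s). *)
Lemma enum_dense (P : pred nat) s M0 : (0 < s)%N ->
  (forall M, (M0 <= M)%N -> (s <= count P (iota M.+1 M))%N) ->
  exists q : nat -> nat, [/\ forall k, P (q k), forall k, (q k < q k.+1)%N
    & forall k, (q (k + s) <= 2 * q k)%N].
Proof.
move=> s0 dense.
have ex M : exists k, P k && (maxn M0 M < k)%N.
  have : has P (iota (maxn M0 M).+1 (maxn M0 M)).
    by rewrite has_count (leq_trans s0) // dense // leq_maxl.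
  by case/hasP=> k; rewrite mem_iota => /andP[h _] Pk; exists k; rewrite Pk.
pose nxt M := ex_minn (ex M).
have nxtP M : P (nxt M) /\ (maxn M0 M < nxt M)%N.
  by rewrite /nxt; case: ex_minnP => k /andP[].
have nxt_min M k : P k -> (maxn M0 M < k)%N -> (nxt M <= k)%N.
  by rewrite /nxt; case: ex_minnP => j _ h Pk lk; apply: h; rewrite Pk.
pose q k := iter k nxt (nxt 0%N).
have qS k : q k.+1 = nxt (q k) by [].
have qP k : P (q k) by case: k => [|k]; apply: (nxtP _).1.
have qlt k : (q k < q k.+1)%N by have [_] := nxtP (q k); rewrite -qS; lia.
have qM k : (M0 < q k)%N.
  by case: k => [|k]; [have [_] := nxtP 0%N | have [_] := nxtP (q k); rewrite -qS];
     rewrite /q /=; lia.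
have between k t y : P y -> (q k < y)%N -> (y < q (k + t))%N ->
    y \in [seq q i | i <- iota k.+1 t.-1].
  move=> Py ky; elim: t => [|t IH]; first by rewrite addn0; lia.
  rewrite addnS => yt; have [yt'|ty] := ltnP y (q (k + t)%N).
    have := IH yt'; case/mapP => i; rewrite mem_iota => hi ->.
    by apply: map_f; rewrite mem_iota; lia.
  have yE : y = q (k + t)%N.
    apply/eqP; rewrite eqn_leq ty andbT leqNgt; apply/negP => ty'.
    have : (nxt (q (k + t)%N) <= y)%N.
      by apply: nxt_min => //; have := qM (k + t)%N; lia.
    by rewrite -qS; lia.
  have t0 : (0 < t)%N.
    by case: t yE {IH yt ty} => // yE; move: ky; rewrite yE addn0 ltnn.
  by rewrite yE; apply: map_f; rewrite mem_iota; lia.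
exists q; split => // k; rewrite leqNgt; apply/negP => lt.
have := dense (q k) (ltnW (qM k)); apply/negP; rewrite -ltnNge -size_filter.
apply: (@leq_ltn_trans (size [seq q i | i <- iota k.+1 s.-1])).
  apply: uniq_leq_size; first by rewrite filter_uniq ?iota_uniq.
  move=> y; rewrite mem_filter mem_iota => /andP[Py] hy.
  by apply: between => //; lia.
by rewrite size_map size_iota; lia.
Qed.

(** * Distances to nearest neighbours and records *)

Local Open Scope classical_set_scope.
Local Open Scope ring_scope.

Section Records.
Variables (R : realType) (n : nat) (f : inner_product R n) (alpha : 'rV[R]_n).

(** The distance from k alpha to the integer lattice. *)
Definition latdist (k : nat) : R := rho f (alpha *+ k) 0.

(** The minimum of latdist over 1, ..., m; the value at m = 0 is chosen so that
    the value at m = 1 is latdist 1. *)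
Fixpoint mindist (m : nat) : R :=
  if m is k.+1 then Num.min (mindist k) (latdist m) else latdist 1.

(** m > 1 is a record when m alpha is strictly closer to the integer lattice than
    all its predecessors. *)
Definition record (m : nat) : bool := (1 < m)%N && (mindist m < mindist m.-1).

Lemma rho_sub x y : rho f x y = rho f (x - y) 0.
Proof. by rewrite /rho subr0. Qed.

Lemma rhoC x y : rho f x y = rho f y x.
Proof.
suff sub a b : [set ipnorm f (a - b - z) | z in @Zvec R n] `<=`
               [set ipnorm f (b - a - z) | z in @Zvec R n].
  by rewrite /rho; congr inf; apply/seteqP; split; exact: sub.
move=> _ [_ [z _ <-] <-]; exists (map_mx (fun k : int => k%:~R) (- z)).
  by exists (- z).
rewrite /ipnorm -innerN; congr (Num.sqrt (f _ _));
  by apply/rowP => i; rewrite !mxE intrN; ring.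
Qed.

Lemma rho_mulrn q t : rho f (alpha *+ q) (alpha *+ t) =
  latdist (maxn q t - minn q t).
Proof.
wlog tq : q t / (t <= q)%N.
  move=> W; case/orP: (leq_total t q) => h; first exact: W.
  by rewrite rhoC maxnC minnC; apply: W.
by rewrite (maxn_idPl tq) (minn_idPr tq) /latdist rho_sub mulrnBr.
Qed.

Lemma mindist_le m k : (0 < k <= m)%N -> mindist m <= latdist k.
Proof.
elim: m => [|m IH]; first by lia.
move=> /andP[k0]; rewrite leq_eqVlt ltnS /= ge_min => /orP[/eqP->|km].
  by rewrite lexx orbT.
by rewrite IH ?k0.
Qed.

Lemma mindist_attained m : (0 < m)%N ->
  exists2 k, (0 < k <= m)%N & mindist m = latdist k.
Proof.
elim: m => // -[|m] IH _; first by exists 1%N; rewrite //= minxx.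
have [k km e] := IH isT; rewrite [mindist _]/=; case: leP => h.
  by exists k; [lia|].
by exists m.+2; [lia|].
Qed.

(** The differences q - t range, up to sign, over 1, ..., max (q, N - q). *)
Lemma nn_dist_mindist N q : (0 < N)%N -> (q <= N)%N ->
  nn_dist f alpha N q = mindist (maxn q (N - q)).
Proof.
move=> N0 qN; rewrite /nn_dist; set E := (X in inf X).
have lbE : lbound E (mindist (maxn q (N - q))).
  move=> _ [t [tN /eqP tq] <-]; rewrite rho_mulrn; apply: mindist_le; lia.
have : E (mindist (maxn q (N - q))).
  have [|k km ->] := @mindist_attained (maxn q (N - q)); first by lia.
  have [kq|kq] := leqP k q.
    exists (q - k)%N; first by split; [lia | apply/eqP; lia].
    by rewrite rho_mulrn; congr latdist; lia.
  exists (q + k)%N; first by split; [lia | apply/eqP; lia].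
  by rewrite rho_mulrn; congr latdist; lia.
move=> hE; apply/eqP; rewrite eq_le; apply/andP; split.
  by apply: ge_inf => //; exists (mindist (maxn q (N - q))).
by apply: lb_le_inf => //; exists (mindist (maxn q (N - q))).
Qed.

(** The function mindist takes a new value exactly at records. *)
Lemma size_undup_mindist M L : (0 < M)%N ->
  (size (undup [seq mindist m | m <- iota M L.+1]) <=
   (count record (iota M.+1 L)).+1)%N.
Proof.
move=> M0; elim: L => [|L IH] //.
have iotaS a k : iota a k.+1 = iota a k ++ [:: (a + k)%N].
  by rewrite -addn1 iotaD.
rewrite (iotaS M L.+1) (iotaS M.+1 L) map_cat count_cat [map _ [:: _]]/= [count _ [:: _]]/= addn0.
set s := map _ _; rewrite -/s in IH; have -> : (M + L.+1 = M.+1 + L)%N by lia.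
have [xs|xs] := boolP (mindist (M.+1 + L) \in s).
  apply: leq_trans (leq_trans IH (leq_addr _ _)).
  apply: uniq_leq_size (undup_uniq _) _ => y.
  by rewrite !mem_undup mem_cat mem_seq1 => /orP[//|/eqP->].
have -> : record (M.+1 + L).
  rewrite /record; apply/andP; split; first by lia.
  rewrite addSn /= lt_neqAle ge_min lexx /= andbT.
  apply: contraNneq xs => e; rewrite addSn [mindist _]/= e /s.
  by apply: map_f; rewrite mem_iota; lia.
rewrite cats1 undup_rcons size_rcons addn1 ltnS size_filter.
exact: leq_trans (count_size _ _) IH.
Qed.

(** For N = 2M and 0 <= q <= N, max (q, N - q) ranges over M, ..., 2M. *)
Lemma nb_dist_le_records M : (0 < M)%N ->
  (nb_dist f alpha (M + M) <= (count record (iota M.+1 M)).+1)%N.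
Proof.
move=> M0; apply: leq_trans (size_undup_mindist M M0).
apply: uniq_leq_size (undup_uniq _) _ => y; rewrite !mem_undup.
case/mapP => q; rewrite mem_iota => hq ->.
by rewrite nn_dist_mindist ?map_f ?mem_iota; lia.
Qed.

Lemma latdist_le_ipnorm (w : int * 'rV[int]_n) :
  0 < w.1 -> latdist `|w.1|%N <= ipnorm f (disp alpha w).
Proof.
move=> w0; apply: ge_inf.
  by exists 0 => _ [z _ <-]; exact: sqrtr_ge0.
exists (map_mx (fun k : int => k%:~R) w.2); first by exists w.2.
congr (ipnorm f _); rewrite subr0 /disp; congr (_ - _).
by rewrite -[in RHS](gez0_abs (ltW w0)).
Qed.

(** The infimum in latdist need not be attained: a displacement shorter than
    mindist (m - 1) is enough. *)
Lemma record_minimal m : record m ->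
  exists2 w, minimal f alpha w & w.1 = m%:Z.
Proof.
case/andP=> m1; case: m m1 => // m m1 /=; rewrite gt_min ltxx /= => lt.
have [|_ [_ [z _ <-] <-] lz] := @inf_lt R _ (mindist m) _ lt.
  by exists (ipnorm f (alpha *+ m.+1 - 0 - map_mx intr (0 : 'rV[int]_n))),
    (map_mx intr (0 : 'rV[int]_n)) => //; exists 0.
exists (m.+1%:Z, z) => //; split => // y y0 ym.
rewrite ltNge; apply/negP => /ler_wsqrtr.
rewrite -/(ipnorm _ _) -/(ipnorm _ _); apply/negP; rewrite -ltNge.
apply: lt_le_trans (latdist_le_ipnorm y0).
have e : disp alpha (m.+1%:Z, z) = alpha *+ m.+1 - 0 - map_mx (fun k : int => k%:~R) z.
  by rewrite subr0.
rewrite e; apply: lt_le_trans lz _; apply: mindist_le; move: ym => /=; lia.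
Qed.

End Records.

(** * The limit inferior *)

Lemma limn_einf_gt (R : realType) (u : (\bar R)^nat) (l : \bar R) :
  (l < limn_einf u)%E -> exists N, forall k, (N <= k)%N -> (l < u k)%E.
Proof.
rewrite limn_einf_lim (cvg_lim _ (@cvg_einfs_sup R u)) //.
case/ereal_sup_gt => _ [N _ <-] h; exists N => k Nk; apply: lt_le_trans h _.
by apply: ereal_inf_lbound; exists k.
Qed.

(** If all but finitely many numbers of distances exceeded s, every interval
    (M, 2M] with M large would contain s records, so that each
    run of s records at most doubles them; this is slower growth than the one
    given by minimal_growth. *)
Lemma liminf_nb_dist_le (R : realType) n (f : inner_product R n.+1)
    (alpha : 'rV[R]_n.+1) s :
  2 ^+ (2 ^ n) < golden R ^+ s -> (liminf_nb_dist f alpha <= (s%:R : R)%:E)%E.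
Proof.
move=> gs; rewrite leNgt; apply/negP => /limn_einf_gt[N0 large].
have ms : (2 ^ n < s)%N.
  rewrite -(@ltr_eXn2l R 2) ?ltr1n //; apply: lt_le_trans gs _.
  by rewrite lerXn2r ?nnegrE //; have := golden_gt1 R; have := golden_lt2 R; lra.
have dense M : (maxn 1 N0 <= M)%N -> (s <= count (record f alpha) (iota M.+1 M))%N.
  rewrite geq_max => /andP[M0 NM].
  have := large (M + M)%N (leq_trans NM (leq_addr _ _)).
  by rewrite lte_fin ltr_nat => h; have := nb_dist_le_records f alpha M0; lia.
have [|q [recq qlt qdbl]] := enum_dense _ dense; first by lia.
have homoq : {homo q : i j / (i < j)%N} by apply: homo_ltn qlt; exact: ltn_trans.
have /choice[x xP] k : exists w, minimal f alpha w /\ w.1 = (q k)%:Z.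
  by have [w] := record_minimal (recq k); exists w.
have q0 k : (0 < q k)%N by have [[+ _] e] := xP k; rewrite e.
suff : golden R ^+ s <= 2 ^+ (2 ^ n) by rewrite leNgt gs.
apply: (@golden_growth R q) => // k.
pose y i := x (k + i)%N.
have y1 i : (y i).1 = (q (k + i)%N)%:Z by have [] := xP (k + i)%N.
have := @minimal_growth R n f alpha y; rewrite !y1 addn0 expnS mul2n addnn => h.
suff : (q (k + 2 ^ n)%N)%:Z + (q k)%:Z <= (q (k + (2 ^ n).*2)%N)%:Z by lia.
apply: h => [i | i j ij | ].
- by have [] := xP (k + i)%N.
- by rewrite !y1; have := homoq (k + i)%N (k + j)%N; rewrite ltn_add2l => /(_ ij); lia.
- have := qdbl k; have := homoq (k + 2 ^ n)%N (k + s)%N.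
  by rewrite ltn_add2l => /(_ ms); lia.
Qed.

Lemma liminf_nb_dist_le_floor (R : realType) n (f : inner_product R n.+1)
    (alpha : 'rV[R]_n.+1) :
  (liminf_nb_dist f alpha <=
   ((Num.floor ((2 : R) ^+ n * (ln 2 / ln (golden R))) + 1)%:~R : R)%:E)%E.
Proof.
set c := _ * _; have g1 := golden_gt1 R.
have lg : 0 < ln (golden R) by exact: ln_gt0.
have l2 : 0 < ln (2 : R) by apply: ln_gt0; rewrite ltr1n.
have c0 : 0 <= c by rewrite mulr_ge0 ?exprn_ge0 // divr_ge0 // ltW.
have : 0 <= Num.floor c by rewrite floor_ge0.
have := floorD1_gt c; case: (Num.floor c) => // s hs _.
have -> : (Posz s + 1)%:~R = s.+1%:R :> R by rewrite -natr1 intrD.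
apply: liminf_nb_dist_le; rewrite -ltr_ln ?posrE ?exprn_gt0 //; last by lra.
rewrite !lnXn //; last by lra.
move: hs; rewrite intrD natr1 /c mulrA ltr_pdivrMr //.
by rewrite -[ln 2 *+ _]mulr_natl natrX mulr_natl.
Qed.

(** Equivalent to golden ^ 3 > 4. *)
Lemma log2_golden (R : realType) : ln 2 / ln (golden R) < 3 / 2 :> R.
Proof.
have g1 := golden_gt1 R; have gsq := golden_sq R.
have lg : 0 < ln (golden R) by exact: ln_gt0.
rewrite ltr_pdivrMr //.
have : ln (2 ^+ 2) < ln (golden R ^+ 3) :> R.
  rewrite ltr_ln ?posrE ?exprn_gt0 //; last by lra.
  have : 3 / 2 < golden R by nra.
  by rewrite [golden R ^+ 3]exprS gsq; nra.
by rewrite !lnXn //; lra.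
Qed.

Theorem corollary2 (R : realType) :
  [/\ forall (n : nat) (f : inner_product R n) (alpha : 'rV[R]_n),
        (2 <= n)%N -> ~ Qvec alpha ->
        (liminf_nb_dist f alpha <=
         ((Num.floor ((2 : R) ^+ (n - 1) * (ln 2 / ln (golden R))) + 1)%:~R : R)%:E)%E,
      forall (f : inner_product R 2) (alpha : 'rV[R]_2),
        ~ Qvec alpha -> (liminf_nb_dist f alpha <= (3 : R)%:E)%E
    & forall (f : inner_product R 3) (alpha : 'rV[R]_3),
        ~ Qvec alpha -> (liminf_nb_dist f alpha <= (6 : R)%:E)%E].
Proof.
have lt := log2_golden R; split.
- move=> [|n] // f alpha _ _; rewrite subn1; exact: liminf_nb_dist_le_floor.
- move=> f alpha _; apply: le_trans (liminf_nb_dist_le_floor f alpha) _.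
  rewrite lee_fin -[leRHS]/(3%:Z%:~R) ler_int.
  have : Num.floor ((2 : R) ^+ 1 * (ln 2 / ln (golden R))) < 3.
    by rewrite floor_lt_int expr1 -[ltRHS]/(3%:R); lra.
  by lia.
- move=> f alpha _; apply: le_trans (liminf_nb_dist_le_floor f alpha) _.
  rewrite lee_fin -[leRHS]/(6%:Z%:~R) ler_int.
  have : Num.floor ((2 : R) ^+ 2 * (ln 2 / ln (golden R))) < 6.
    by rewrite floor_lt_int -[ltRHS]/(6%:R) expr2; lra.
  by lia.
Qed.
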